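(* Let $V$ be a finite dimensional vector space over a field with ordered basis $v_1<\dots<v_d$, and let $\mathcal{B}$ be the set of Lyndon-Shirshov words in the alphabet $\{v_1,\dots,v_d\}$, ordered lexicographically. If $\omega,\upsilon\in\mathcal{B}$ and $\omega<\upsilon$, then $\langle\omega^*,\mathcal{L}\upsilon\rangle=0$. Furthermore, $\langle\omega^*,\mathcal{L}\omega\rangle=\pm1$ for every $\omega\in\mathcal{B}$.
   Context: **Trees, graphs and the configuration pairing.** A tree is a finite rooted binary tree embedded in the upper half plane; a graph is a finite oriented, connected, acyclic graph (acyclic as an undirected graph). $\mathrm{Tr}(V)$ is the vector space spanned by trees with leaves labeled by elements of $V$, modulo multilinearity in the labels; $\mathrm{Gr}(V^* )$ is the vector space spanned by graphs with vertices labeled by elements of $V^*$, modulo multilinearity in the labels. For trees $\tau_1,\tau_2$, $[\tau_1,\tau_2]$ is the tree whose root has left branch $\tau_1$ and right branch $\tau_2$. For a graph $G$, a tree $T$ and a bijection $\sigma:\mathrm{Vertices}(G)\to\mathrm{Leaves}(T)$, let $\beta_\sigma$ send an edge $a\to b$ of $G$ to the internal vertex of $T$ closest to the root on the path from leaf $\sigma(a)$ to leaf $\sigma(b)$, with sign $+1$ if $\sigma(a)$ is left of $\sigma(b)$ in the planar embedding and $-1$ if it is to the right. Set $\langle G,T\rangle_\sigma$ to be the product of these signs over all edges if $\beta_\sigma:\mathrm{Edges}(G)\to\{\text{internal vertices of }T\}$ is surjective, and $0$ otherwise. For labeled $\gamma=(G,l_G)$, $\tau=(T,l_T)$ set $\langle\gamma,\tau\rangle=\sum_\sigma\langle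 G,T\rangle_\sigma\prod_{v}\langle l_G(v),l_T(\sigma(v))\rangle$, summing over all bijections $\sigma$ and taking the product over vertices $v$ of $G$ ($0$ if there are no bijections); extend bilinearly to $\mathrm{Gr}(V^* )\times\mathrm{Tr}(V)$. **Words.** $\mathcal{A}$ is the set of finite nonempty words in the ordered alphabet $v_1<\dots<v_d$, with lexicographic order (a proper prefix is smaller). $\mathcal{B}\subset\mathcal{A}$ is the set of words strictly smaller than all their nontrivial cyclic rotations. A simple word in an alphabet is a word $x^k y_1\cdots y_\ell$ with $k,\ell>0$ and $y_i\ne x$ for all $i$; two simple words are compatible if their initial letters $x$ coincide. $\mathcal{A}_0$ is the set of one-letter words, $\mathcal{A}_1$ the set of simple words, and, for $m>1$, $\mathcal{A}_m$ is the set of words which are simple words in an alphabet of mutually compatible elements of $\mathcal{A}_{m-1}$. The $\mathcal{A}_m$ are disjoint, and for $m\ge1$ an element of $\mathcal{A}_m$ is uniquely of the form $\omega^k\psi_1\cdots\psi_\ell$ with $\omega,\psi_i\in\mathcal{A}_{m-1}$ (mutually compatible if $m>1$), $\psi_i\neq\omega$, $k,\ell>0$. Put $\mathcal{B}_m=\mathcal{B}\cap\mathcal{A}_m$; every word of $\mathcal{B}$ lies in exactly one $\mathcal{B}_m$, and if $\omega^k\psi_1\cdots\psi_\ell\in\mathcal{B}_m$ then $\omega,\psi_i\in\mathcal{B}_{m-1}$. **The maps $\mathcal{L}$ and $(-)^*$.** $\mathcal{L}v_i=v_i$, and for $\omega^k\psi_1\cdots\psi_\ell\in\mathcal{B}_m$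 ($m\ge1$, written in its unique decomposition with $\omega,\psi_i\in\mathcal{A}_{m-1}$, mutually compatible if $m>1$, $\psi_i\neq\omega$, $k,\ell>0$), $\mathcal{L}(\omega^k\psi_1\cdots\psi_\ell)$ is the left-normed bracket $$[[\cdots[[[\cdots[\mathcal{L}\psi_1,\mathcal{L}\omega],\cdots],\mathcal{L}\omega],\mathcal{L}\psi_2],\cdots],\mathcal{L}\psi_\ell]\in\mathrm{Tr}(V)$$ with $\mathcal{L}\omega$ occurring $k$ times. For a word $\omega=y_1y_2\cdots y_n$ with letters $y_i\in\{v_1,\dots,v_d\}$, $\omega^*=y_1^*|y_2^*|\cdots|y_n^*$ denotes the linear (''long'') graph $y_1^*\to y_2^*\to\cdots\to y_n^*$, where $v_1^*,\dots,v_d^*$ is the dual basis of $V^*$. *)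

(* Defs.v *)
From mathcomp Require Import all_boot all_order all_algebra.
From Stdlib Require Import ClassicalEpsilon.

Set Implicit Arguments.
Unset Strict Implicit.
Unset Printing Implicit Defensive.

Import Order.TTheory GRing.Theory.
Local Open Scope ring_scope.

(** * Trees *)

Inductive tree (A : Type) : Type :=
| Leaf of A
| Bracket of tree A & tree A.

(* A vertex of a tree is addressed by the sequence of turns leading to it from
   the root: [false] for the left branch, [true] for the right branch. *)

(* The leaves, from left to right, each with its address and its label. *)
Fixpoint leaves (A : Type) (t : tree A) : seq (seq bool * A) :=
  match t with
  | Leaf a => [:: ([::], a)]
  | Bracket l r => [seq (false :: p.1, p.2) | p <- leaves l] ++
                   [seq (true :: p.1, p.2) | p <- leaves r]
  end.

Fixpoint internal_vertices (A : Type) (t : tree A) : seq (seq bool) :=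
  match t with
  | Leaf _ => [::]
  | Bracket l r => [::] :: [seq false :: p | p <- internal_vertices l] ++
                           [seq true :: p | p <- internal_vertices r]
  end.

(* Leaves are numbered from left to right, so that [i] is to the left of [j]
   exactly when [i < j]. *)
Definition leaf (A : Type) (t : tree A) := 'I_(size (leaves t)).

Definition leaf_addr (A : Type) (t : tree A) (i : leaf t) : seq bool :=
  (tnth (in_tuple (leaves t)) i).1.

Definition leaf_label (A : Type) (t : tree A) (i : leaf t) : A :=
  (tnth (in_tuple (leaves t)) i).2.

(* Longest common prefix.  The path between two vertices goes up from one of
   them to their longest common prefix and then down to the other, so this is
   the vertex of the path which is closest to the root. *)
Fixpoint meet_addr (p q : seq bool) : seq bool :=
  match p, q with
  | b :: p', c :: q' => if b == c then b :: meet_addr p' q' else [::]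
  | _, _ => [::]
  end.

(** * Graphs *)

Definition undirected (T : Type) (e : rel T) : rel T :=
  [rel a b | e a b || e b a].

(* Acyclicity of the underlying undirected graph: [edge_asym] excludes loops and
   pairs of opposite edges, [edge_acyclic] excludes longer simple cycles. *)
Record graph : Type := Graph {
  vertex : finType;
  edge : rel vertex;
  edge_asym : forall a b, edge a b -> ~~ edge b a;
  edge_connected : forall a b, connect (undirected edge) a b;
  edge_acyclic : forall c : seq vertex,
    uniq c -> (2 < size c)%N -> ~~ cycle (undirected edge) c
}.

Definition edges (G : graph) : {set vertex G * vertex G} :=
  [set e | edge e.1 e.2].

Section LongGraph.

Variable n : nat.

Definition long_edge : rel 'I_n := [rel i j : 'I_n | j == i.+1 :> nat].

Lemma long_edge_asym (i j : 'I_n) : long_edge i j -> ~~ long_edge j i.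
Proof.
move=> /eqP ji; apply/negP => /eqP ij.
by have: (i < j)%N; [rewrite ji | rewrite ij ltnNge leqnSn].
Qed.

Lemma long_edge_connected (i j : 'I_n) : connect (undirected long_edge) i j.
Proof.
have sym : connect_sym (undirected long_edge).
  by apply: sym_connect_sym => a b; rewrite /undirected /= orbC.
suff up m (a b : 'I_n) : b = (a + m)%N :> nat ->
    connect (undirected long_edge) a b.
  have [le_ij|/ltnW le_ji] := leqP i j.
    by apply: (up (j - i)%N); rewrite subnKC.
  by rewrite sym; apply: (up (i - j)%N); rewrite subnKC.
elim: m b => [|m IHm] b; first by rewrite addn0 => /val_inj ->.
rewrite addnS => def_b.
have ltn : (a + m < n)%N by rewrite -def_b ltnW.
apply: connect_trans (IHm (Ordinal ltn) erefl) (connect1 _).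
by rewrite /undirected /long_edge /= def_b eqxx.
Qed.

Lemma long_edge_acyclic (c : seq 'I_n) :
  uniq c -> (2 < size c)%N -> ~~ cycle (undirected long_edge) c.
Proof.
case: c => // i0 c0; set c := i0 :: c0 => c_uniq c_gt2.
have [m m_c m_max] : exists2 m, m \in c & forall i, i \in c -> (i <= m)%N.
  have i0_c : i0 \in c by rewrite mem_head.
  by exists [arg max_(i > i0 in c) val i]; case: arg_maxnP.
have [k p def_c] := rot_to m_c.
have sz_p : (1 < size p)%N by move: c_gt2; rewrite -(size_rot k) def_c.
have p_max i : i \in p -> (i <= m)%N.
  by move=> i_p; apply: m_max; rewrite -(mem_rot k) def_c inE i_p orbT.
rewrite -(rot_uniq k) def_c in c_uniq.
rewrite -(rot_cycle k) def_c; apply/negP.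
have below i : i \in p -> long_edge i m || long_edge m i -> i.+1 = m :> nat.
  by move=> /p_max le_im /orP[] /eqP // def_i; rewrite def_i ltnn in le_im.
case/lastP: p => // p j in sz_p {def_c} p_max below c_uniq *.
case: p => // i p in sz_p p_max below c_uniq *.
rewrite (cycle_path m) /= last_rcons => /and3P[jm mi _].
have def_i : i.+1 = m :> nat by apply: below; [rewrite inE eqxx | rewrite orbC].
have def_j : j.+1 = m :> nat.
  by apply: below; first rewrite mem_rcons mem_head.
have eq_ij : i = j by apply/val_inj/succn_inj; rewrite def_i.
by move: c_uniq; rewrite /= eq_ij mem_rcons mem_head andbF.
Qed.

Definition long_graph : graph :=
  Graph long_edge_asym long_edge_connected long_edge_acyclic.

End LongGraph.

(** * The configuration pairing

   This is the pairing of a labeled graph and a labeled tree.  Being multilinear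
   in the labels, it extends to a bilinear pairing of the spaces spanned by
   labeled graphs and by labeled trees modulo multilinearity in the labels; only
   its values on these generators are needed. *)

Section Pairing.

Variables (K : fieldType) (V : vectType K).

Definition dual := 'Hom(V, K^o).

Record labeled_graph : Type := LabeledGraph {
  graph_of :> graph;
  vertex_label : vertex graph_of -> dual
}.

Section Configuration.

Variables (G : graph) (T : tree V) (s : {ffun vertex G -> leaf T}).

Definition beta (e : vertex G * vertex G) : seq bool :=
  meet_addr (leaf_addr (s e.1)) (leaf_addr (s e.2)).

Definition beta_surjective : bool :=
  all (fun p => [exists e in edges G, beta e == p]) (internal_vertices T).

Definition edge_sign (e : vertex G * vertex G) : K :=
  if (s e.1 < s e.2)%N then 1 else -1.

Definition configuration_pairing : K :=
  if beta_surjective then \prod_(e in edges G) edge_sign e else 0.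

End Configuration.

Definition bijectiveb (A B : finType) (f : {ffun A -> B}) : bool :=
  injectiveb f && [forall b, b \in codom f].

Definition pairing (g : labeled_graph) (t : tree V) : K :=
  \sum_(s : {ffun vertex g -> leaf t} | bijectiveb s)
    configuration_pairing s *
    \prod_(v : vertex g) vertex_label v (leaf_label (s v)).

End Pairing.

(** * Words, the letter [v_(i+1)] being represented by [i : 'I_d] *)

Section Words.

Variable d : nat.

Notation word := (seq 'I_d).

Definition lexlt (u w : word) : Prop :=
  ((u : seqlexi 'I_d) < w)%O.

Definition lyndon (w : word) : Prop :=
  w <> [::] /\ forall i, (0 < i < size w)%N -> lexlt w (rot i w).

(* The word [x^k y_1 ... y_l]. *)
Definition power_cat (x : word) (k : nat) (ys : seq word) : word :=
  flatten (nseq k x ++ ys).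

(* [A_0] is the set of one-letter words, and [A_(m+1)] is the set of words which
   are simple words in an alphabet of elements of [A_m], mutually compatible if
   [m > 0].  [level m w] means that [w] belongs to [A_m]; [decomposition m x k ys]
   means that [x^k y_1 ... y_l] exhibits an element of [A_(m+1)]; [compatible m],
   for [m > 0], means that two elements of [A_m] have the same initial letter,
   itself an element of [A_(m-1)]. *)
Inductive level : nat -> word -> Prop :=
| Level0 i : level 0 [:: i]
| LevelS m x k ys :
    decomposition m x k ys -> level m.+1 (power_cat x k ys)
with decomposition : nat -> word -> nat -> seq word -> Prop :=
| Decomposition m x k ys :
    (0 < k)%N -> (0 < size ys)%N -> x \notin ys ->
    (forall y, y \in x :: ys -> level m y) ->
    ((0 < m)%N ->
      forall y z, y \in x :: ys -> z \in x :: ys -> compatible m y z) ->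
    decomposition m x k ys
with compatible : nat -> word -> word -> Prop :=
| Compatible m x k ys k' ys' :
    decomposition m x k ys -> decomposition m x k' ys' ->
    compatible m.+1 (power_cat x k ys) (power_cat x k' ys').

End Words.

(** * Bracketings and long graphs of words *)

Section Maps.

Variables (K : fieldType) (V : vectType K) (d : nat) (X : d.-tuple V).

Notation word := (seq 'I_d).

(* The recursive clauses of the bracketing map; [f] brackets the factors. *)
Inductive bracketing : word -> tree V -> Prop :=
| BracketingLetter i : bracketing [:: i] (Leaf (tnth X i))
| BracketingSimple m x k y ys (f : word -> tree V) :
    decomposition m x k (y :: ys) -> lyndon (power_cat x k (y :: ys)) ->
    (forall z, z \in [:: x, y & ys] -> bracketing z (f z)) ->
    bracketing (power_cat x k (y :: ys))
      (foldl (fun t z => Bracket t (f z))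
             (iter k (fun t => Bracket t (f x)) (f y)) ys).

(* Every Lyndon-Shirshov word has exactly one bracketing, which [epsilon] picks.
   The value outside the set of Lyndon-Shirshov words is irrelevant. *)
Definition lyndon_bracket (w : word) : tree V :=
  epsilon (inhabits (Leaf 0)) (bracketing w).

Definition dual_basis (i : 'I_d) : dual V := linfun (coord X i : V -> K^o).

Definition dual_word (w : word) : labeled_graph V :=
  @LabeledGraph K V (long_graph (size w))
    (fun i => dual_basis (tnth (in_tuple w) i)).

End Maps.

(* Main.v *)
Require Import Defs.
From mathcomp Require Import all_boot all_order all_algebra.
From Stdlib Require Import ClassicalEpsilon.
Set Implicit Arguments.
Unset Strict Implicit.
Unset Printing Implicit Defensive.
Import Order.TTheory GRing.Theory.
Local Open Scope ring_scope.

(* For the long graph of a word [w], surjectivity of [beta] means that each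
   internal vertex is hit by exactly one edge; hence the path crosses from one
   branch of the root to the other exactly once, and the pairing of [w*] with a
   tree is the coefficient of [w] in the expansion of the tree under
   [a, b] = ab - ba.  If [p] and [q] are the smallest words of two such
   expansions, with coefficients [±1], then the smaller of [pq] and [qp] is the
   smallest word of the expansion of their bracket.

   It remains to compare [pq] with [qp] along the bracketing of a
   Lyndon-Shirshov word [x^k y_1 ... y_l].  Level by level, sequences of
   mutually compatible Lyndon-Shirshov words are ordered lexicographically like
   the underlying words: if [p] is a proper prefix of [q], what remains of [q]
   does not start with the common initial letter [x] of the previous level, hence
   starts with something larger than [x], while whatever follows [p] starts with
   [x].  Since [x < y_i], the order of the factors then decides every comparison. *)

(** * Lyndon words *)

Lemma cat_eq_cat (T : Type) (u v p q : seq T) : u ++ v = p ++ q ->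
  (exists r, p = u ++ r /\ v = r ++ q) \/
  (exists r, [/\ r <> [::], u = p ++ r & q = r ++ v]).
Proof.
elim: u p => [|x u IHu] [|y p] /=.
- by move=> ->; left; exists [::].
- by move=> ->; left; exists (y :: p).
- by move=> <-; right; exists (x :: u).
case=> -> /IHu[[r [-> ->]]|[r [r0 -> ->]]]; first by left; exists r.
by right; exists r.
Qed.

Section LexOrder.

Variable d : nat.
Implicit Types u v w s t p q : seq 'I_d.

Local Open Scope nat_scope.

Lemma lexlt_cons (x y : 'I_d) s t :
  lexlt (x :: s) (y :: t) <-> (x < y)%O \/ x = y /\ lexlt s t.
Proof.
rewrite /lexlt ltxi_cons.
case: (ltgtP x y) => [xy|xy|->] /=; split=> //; try by left.
- by case=> // -[exy]; rewrite exy ltxx in xy.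
- by right.
- by case=> // -[].
Qed.

Lemma lexlt_irr w : ~ lexlt w w.
Proof. by rewrite /lexlt ltxx. Qed.

Lemma lexlt_trans u v w : lexlt u v -> lexlt v w -> lexlt u w.
Proof. exact: (@lt_trans _ (seqlexi 'I_d)). Qed.

Lemma lexlt_asym u v : lexlt u v -> ~ lexlt v u.
Proof. by move=> uv /(lexlt_trans uv); apply: lexlt_irr. Qed.

Lemma lexlt_total u v : u <> v -> lexlt u v \/ lexlt v u.
Proof.
rewrite /lexlt; case: (@ltgtP _ (seqlexi 'I_d) u v) => // _ _; [by left|by right].
Qed.

Lemma lexlt_cat2l c s t : lexlt (c ++ s) (c ++ t) <-> lexlt s t.
Proof.
elim: c => //= x c IHc; rewrite lexlt_cons; split=> [[|[_ /IHc]]|/IHc] //.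
  by rewrite ltxx.
by right.
Qed.

Lemma lexlt_prefix u e : e <> [::] -> lexlt u (u ++ e).
Proof.
move=> e0; rewrite -{1}[u]cats0 lexlt_cat2l.
by rewrite /lexlt; case: e e0 => // a e _; rewrite ltxi0s.
Qed.

(** A proper prefix loses its advantage once words are appended, whereas a first differing letter
    decides whatever is appended on either side. *)
Lemma lexlt_split u v : lexlt u v ->
  (exists2 e, e <> [::] & v = u ++ e) \/
  (forall s t, lexlt (u ++ s) (v ++ t)).
Proof.
elim: u v => [|x u IHu] [|y v] //.
- by move=> _; left; exists (y :: v).
- move/lexlt_cons => [xy|[-> /IHu[[e e0 ->]|uv]]].
  + by right=> s t; apply/lexlt_cons; left.
  + by left; exists e.
  + by right=> s t; apply/lexlt_cons; right.
Qed.

Lemma lexlt_cat u v s t : size u = size v -> lexlt u v -> lexlt (u ++ s) (v ++ t).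
Proof.
move=> szuv /lexlt_split[[e e0 def_v]|//].
move: szuv; rewrite def_v size_cat => /eqP.
by rewrite -[X in X == _]addn0 eqn_add2l => /eqP/esym/size0nil/e0.
Qed.

Lemma lexlt_catW u v s t : size u = size v -> lexlt (u ++ s) (v ++ t) ->
  lexlt u v \/ u = v /\ lexlt s t.
Proof.
move=> szuv lt_us_vt; have [uv|/eqP nuv] := altP (u =P v).
  by right; split=> //; move: lt_us_vt; rewrite uv => /lexlt_cat2l.
by have [|/(lexlt_cat t s (esym szuv))/lexlt_asym] := lexlt_total nuv; [left|].
Qed.

Lemma lyndon_suffix w : lyndon w <->
  w <> [::] /\ forall p q, p <> [::] -> q <> [::] -> w = p ++ q -> lexlt w q.
Proof.
split=> -[w0 Hw]; split=> //; last first.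
  move=> i /andP[i_gt0 i_lt].
  have lt_w : lexlt w (drop i w).
    apply: (Hw (take i w)); last by rewrite cat_take_drop.
      by move/(congr1 size); rewrite size_takel 1?ltnW //= => i0; rewrite i0 in i_gt0.
    by move/(congr1 size)/eqP; rewrite size_drop /= subn_eq0 leqNgt i_lt.
  have [[e e0 def_d]|lt] := lexlt_split lt_w; last first.
    by rewrite /rot -[w in lexlt w]cats0.
  have := congr1 size def_d; rewrite size_drop size_cat => sz.
  have := ltn_subrL i (size w); rewrite sz i_gt0 (ltn_trans i_gt0 i_lt).
  by rewrite ltnNge leq_addr.
move=> p q p0 q0 def_w.
have p_gt0 : 0 < size p by rewrite lt0n size_eq0; apply/eqP.
have q_gt0 : 0 < size q by rewrite lt0n size_eq0; apply/eqP.
have w_qp : lexlt w (q ++ p).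
  have := Hw (size p); rewrite def_w rot_size_cat; apply.
  by rewrite size_cat p_gt0 -[X in X < _]addn0 ltn_add2l.
have nwq : w <> q.
  move/(congr1 size); rewrite def_w size_cat => /eqP.
  by rewrite -[X in _ == X]add0n eqn_add2r => /eqP sp; rewrite sp in p_gt0.
(* Suppose [q < w]. Either a letter decides, and then [q ++ p < w]; or [w = q ++ r] with [r < p],
   and then the rotation [r ++ q] of [w] is below [w = p ++ q]. *)
have [//|/lexlt_split[[r r0 def_w']|lt]] := lexlt_total nwq; last first.
  by have := lt p [::]; rewrite cats0 => /lexlt_asym.
have szpr : size r = size p.
  by apply/eqP; rewrite -(eqn_add2l (size q)) -size_cat -def_w' def_w size_cat addnC.
have rp : lexlt r p by apply/(lexlt_cat2l q); rewrite -def_w'.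
have := Hw (size q); rewrite {3}def_w' rot_size_cat => /(_ _)/lexlt_asym[].
  by rewrite def_w' size_cat q_gt0 -[X in X < _]addn0 ltn_add2l szpr.
by rewrite def_w; apply: lexlt_cat.
Qed.

Lemma lyndon_rot_lt p q : p <> [::] -> q <> [::] -> lyndon (p ++ q) ->
  lexlt (p ++ q) (q ++ p).
Proof.
move=> p0 q0 [_ /(_ (size p))]; rewrite rot_size_cat size_cat; apply.
rewrite -[X in _ && (X < _)]addn0 ltn_add2l !lt0n !size_eq0.
by apply/andP; split; apply/eqP.
Qed.

(** A proper suffix [r] of [u] is larger than [u] but shorter, so a letter decides
    [u ++ v < r ++ v]. Suffixes of [v] are at least [v], and [u ++ v < v]: if [v = u ++ e], this
    reduces to [v < e], where [e] is a suffix of [v]. *)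
Lemma lyndon_cat u v : lyndon u -> lyndon v -> lexlt u v -> lyndon (u ++ v).
Proof.
move=> /lyndon_suffix[u0 Hu] /lyndon_suffix[v0 Hv] uv.
have uv_v : lexlt (u ++ v) v.
  have [[e e0 def_v]|lt] := lexlt_split uv; last by have := lt v [::]; rewrite cats0.
  by rewrite [X in lexlt _ X]def_v; apply/lexlt_cat2l; apply: Hv def_v.
apply/lyndon_suffix; split=> [|p q p0 q0].
  by move/(congr1 size)/eqP; rewrite size_cat addn_eq0 size_eq0 => /andP[/eqP/u0].
case/cat_eq_cat=> [[[|x r] [def_p def_v]]|[r [r0 def_u ->]]].
- by rewrite -[q in lexlt _ q]/([::] ++ q) -def_v.
- by apply: lexlt_trans uv_v _; apply: Hv def_v.
have /lexlt_split[[e e0 def_r]|//] := Hu p r p0 r0 def_u.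
have := congr1 size def_r; rewrite def_u !size_cat => /eqP.
rewrite addnAC -[X in X == _]add0n eqn_add2r eq_sym addn_eq0 size_eq0.
by case/andP=> /eqP/p0.
Qed.

End LexOrder.

(** * Uniqueness of decompositions *)

Section Blocks.

Variable T : eqType.
Implicit Types (x y : T) (s g : seq T) (gs : seq (seq T)).

Local Open Scope nat_scope.

Definition is_block x g := exists k zs,
  [/\ g = nseq k x ++ zs, 0 < k, 0 < size zs & x \notin zs].

(** A block ends in an item other than [x] and the next one starts with [x]; such places, and no
    others, are cut. The default of [head] is never consulted, [s'] being nonempty there. *)
Fixpoint blocks x s : seq (seq T) :=
  if s is y :: s' then
    if blocks x s' is b :: bs then
      if (y != x) && (head y s' == x) then [:: [:: y], b & bs] else (y :: b) :: bs
    else [:: [:: y]]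
  else [::].

Lemma blocks_step x y s : blocks x (y :: s) =
  if blocks x s is b :: bs then
    if (y != x) && (head y s == x) then [:: [:: y], b & bs] else (y :: b) :: bs
  else [:: [:: y]].
Proof. by []. Qed.

Lemma is_block_cons x g : is_block x g -> exists g', g = x :: g'.
Proof. by case=> -[|k] [zs [-> // _ _ _]]; exists (nseq k x ++ zs). Qed.

Lemma size_block x g : is_block x g -> 1 < size g.
Proof.
case=> k [zs [-> k0 zs0 _]]; rewrite size_cat size_nseq.
by apply: (leq_add k0 zs0).
Qed.

Lemma flatten_blocks_head x gs :
  (forall g, g \in gs -> is_block x g) -> gs <> [::] ->
  exists s, flatten gs = x :: s.
Proof.
case: gs => // g gs Hgs _; have [|g' ->] := is_block_cons (Hgs g _).
  exact: mem_head.
by exists (g' ++ flatten gs).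
Qed.

Lemma blocks_cons x s : s <> [::] -> exists b bs, blocks x s = b :: bs.
Proof.
case: s => // y s _ /=; case: (blocks x s) => [|b bs]; first by exists [:: y], [::].
by case: ifP => _; do 2!eexists.
Qed.

Lemma blocks_cat x g s : is_block x g -> s = [::] \/ head x s = x ->
  blocks x (g ++ s) = g :: blocks x s.
Proof.
case=> k [zs [-> _ zs0 xzs]] hs; rewrite -catA.
have{zs0 xzs}: blocks x (zs ++ s) = zs :: blocks x s.
  elim: zs zs0 xzs => // z [|z' zs] IHzs _ xzs.
    rewrite inE eq_sym in xzs; case: s hs {IHzs} => // y s [//|def_y].
    rewrite /= in def_y.
    have [b [bs def_b]] : exists b bs, blocks x (y :: s) = b :: bs.
      exact: blocks_cons.
    by rewrite cat1s blocks_step def_b xzs -[head _ _]/y def_y eqxx.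
  move: xzs; rewrite inE negb_or => /andP[_ xzs]; rewrite cat_cons blocks_step IHzs //.
  by move: xzs; rewrite inE negb_or eq_sym => /andP[/negPf /= -> _]; rewrite andbF.
by elim: k => //= k IHk /IHk ->; rewrite eqxx.
Qed.

Lemma blocks_flatten x gs :
  (forall g, g \in gs -> is_block x g) -> blocks x (flatten gs) = gs.
Proof.
elim: gs => //= g gs IHgs Hgs.
have Hgs' g' : g' \in gs -> is_block x g'.
  by move=> g'_in; apply: Hgs; rewrite inE g'_in orbT.
rewrite blocks_cat ?IHgs //; first by apply: Hgs; rewrite mem_head.
have [->|/eqP gs0] := eqVneq gs [::]; first by left.
by have [s ->] := flatten_blocks_head Hgs' gs0; right.
Qed.

(** Read from the right: an item other than [x] joins the [x]-free prefix, while [x] turns a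
    nonempty prefix into a new block, or else lengthens the initial run of the first block. *)
Lemma exists_blocks x s z : z != x ->
  exists zs gs, [/\ rcons s z = zs ++ flatten gs, x \notin zs &
                 forall g, g \in gs -> is_block x g].
Proof.
move=> zx; elim: s => [|y s [zs [gs [def_s xzs Hgs]]]] /=.
  by exists [:: z], [::]; split; rewrite ?inE // eq_sym.
rewrite def_s; have [->|yx] := eqVneq y x; last first.
  by exists (y :: zs), gs; split=> //; rewrite inE negb_or eq_sym yx.
exists [::]; case: zs => [|z' zs] in def_s xzs *; last first.
  exists ((x :: z' :: zs) :: gs); split=> // g; rewrite inE => /predU1P[->|/Hgs//].
  by exists 1, (z' :: zs).
case: gs => [|g gs] in def_s Hgs *; first by case: s def_s.
exists ((x :: g) :: gs); split=> // h; rewrite inE => /predU1P[->|h_gs]; last first.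
  by apply: Hgs; rewrite inE h_gs orbT.
have [|k [ys [-> k0 ys0 xys]]] := Hgs g; first exact: mem_head.
by exists k.+1, ys.
Qed.

End Blocks.

(** * Unique readability of words, level by level *)

Section Levels.

Variable d : nat.
Notation word := (seq 'I_d).
Implicit Types (w x y z : word) (Z ys : seq word).

Local Open Scope nat_scope.

(* Iterating [regroup] on the sequence of letters of a word recovers its
   decomposition at every level, whence uniqueness. *)
Definition regroup Z : seq word :=
  if Z is x :: _ then [seq flatten b | b <- blocks x Z] else [::].

(** This keeps the levels apart: once a word has become a single item, it is never split again. *)
Lemma size_iter_regroup1 n w : size (iter n regroup [:: w]) <= 1.
Proof. by elim: n => //= n; case: (iter n _ _) => // y []. Qed.

Definition letters w : seq word := [seq [:: i] | i <- w].

Definition alphabet m Z :=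
  (forall y, y \in Z -> level m y) /\
  (0 < m -> forall y z, y \in Z -> z \in Z -> compatible m y z).

Lemma alphabet_sub m Z Z' : {subset Z' <= Z} -> alphabet m Z -> alphabet m Z'.
Proof.
move=> sZ [levZ cZ]; split=> [y /sZ/levZ //|m0 y z /sZ yZ /sZ zZ].
exact: cZ.
Qed.

Lemma level_inv m w : level m w ->
  if m is m'.+1 then
    exists x k ys, decomposition m' x k ys /\ w = power_cat x k ys
  else exists i, w = [:: i].
Proof. by case=> [i|{}m x k ys D]; [exists i | exists x, k, ys]. Qed.

Lemma compatible_inv m u w : compatible m u w ->
  if m is m'.+1 then
    exists x k ys k' ys', [/\ decomposition m' x k ys, decomposition m' x k' ys',
      u = power_cat x k ys & w = power_cat x k' ys']
  else False.
Proof. by case=> {}m x k ys k' ys' D D'; exists x, k, ys, k', ys'. Qed.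

Lemma decomposition_inv m x k ys : decomposition m x k ys ->
  [/\ 0 < k, is_block x (nseq k x ++ ys), alphabet m (x :: ys) &
      alphabet m (nseq k x ++ ys)].
Proof.
case=> {}m {}x {}k {}ys k0 ys0 xys lev comp.
have F : alphabet m (x :: ys) by [].
split=> //; first by exists k, ys.
apply: alphabet_sub F => y; rewrite mem_cat mem_nseq inE.
by case/orP=> [/andP[_ ->]|->]; rewrite ?orbT.
Qed.

Lemma decomposition_block m x k ys : 0 < k -> 0 < size ys -> x \notin ys ->
  alphabet m (x :: ys) -> decomposition m x k ys.
Proof. by move=> k0 ys0 xys [lev c]; apply: Decomposition. Qed.

(** Unique readability at level [m]: the sequence [Z] is a function of the word that it spells. *)
Definition parses m := forall Z, Z <> [::] -> alphabet m Z ->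
  iter m regroup (letters (flatten Z)) = Z.

Lemma parses_inj m x k ys x' k' ys' : parses m ->
  decomposition m x k ys -> decomposition m x' k' ys' ->
  power_cat x k ys = power_cat x' k' ys' ->
  nseq k x ++ ys = nseq k' x' ++ ys'.
Proof.
move=> R /decomposition_inv[k0 _ _ f] /decomposition_inv[k'0 _ _ f'] eq_w.
have R1 : iter m regroup (letters (power_cat x k ys)) = nseq k x ++ ys.
  by apply: R f; case: k k0 {eq_w}.
have R2 : iter m regroup (letters (power_cat x' k' ys')) = nseq k' x' ++ ys'.
  by apply: R f'; case: k' k'0 {eq_w R1}.
by rewrite -R1 eq_w.
Qed.

(** The middle word comes with two decompositions, whose initial letters agree by unique
    readability. *)
Lemma compatible_trans_step m : parses m ->
  forall u v w, compatible m.+1 u v -> compatible m.+1 v w -> compatible m.+1 u w.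
Proof.
move=> R u v w /compatible_inv[x [k [ys [k1 [ys1 [D D1 -> ->]]]]]].
case/compatible_inv=> [x' [k2 [ys2 [k' [ys' [D2 D' eq_v ->]]]]]].
have := parses_inj R D1 D2 eq_v.
have [k10 _ _ _] := decomposition_inv D1; have [k20 _ _ _] := decomposition_inv D2.
case: k1 k2 k10 k20 {D1 D2 eq_v} => [|k1] [|k2] // _ _ [eq_x _].
by rewrite -eq_x in D' *; apply: Compatible D D'.
Qed.

(** Compatibility with the first word forces its initial letter [x] on all words of [Z]. Their
    factors are then compatible with [x] and, through [x], with each other. *)
Lemma alphabet_blocks m Z : parses m ->
  (forall u v w : word, compatible m u v -> compatible m v w -> compatible m u w) ->
  Z <> [::] -> alphabet m.+1 Z ->
  exists x gs, [/\ Z = [seq flatten g | g <- gs],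
    forall g, g \in gs -> is_block x g & alphabet m (flatten gs)].
Proof.
move=> R trans; case: Z => // y0 Z _ [lev comp].
have [x [k [ys [D def_y0]]]] := level_inv (lev _ (mem_head _ _)).
exists x.
have: forall y, y \in y0 :: Z -> exists g,
    [/\ flatten g = y, is_block x g & alphabet m (x :: g)].
  move=> y yZ; have := comp isT _ _ (mem_head _ _) yZ.
  case/compatible_inv=> x' [k1 [ys1 [k2 [ys2 [D1 D2]]]]].
  rewrite def_y0 => eq_y0 ->.
  have := parses_inj R D D1 eq_y0; have [k_gt0 _ _ _] := decomposition_inv D.
  have [k1_gt0 _ _ _] := decomposition_inv D1.
  case: k k1 k_gt0 k1_gt0 {D D1 def_y0 eq_y0} => [|k] [|k1] // _ _ [eq_x _].
  rewrite -eq_x in D2; have [_ b f _] := decomposition_inv D2.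
  exists (nseq k2 x ++ ys2); rewrite -?eq_x; split=> //.
    apply: alphabet_sub f => z; rewrite !inE mem_cat mem_nseq.
  by case/or3P=> [->|/andP[_ ->]|->]; rewrite ?orbT.
elim: (y0 :: Z) => [|y Z1 IHZ] HZ.
  by exists [::]; split=> //; split.
have [gs [-> bl [fl fc]]] := IHZ (fun u uZ => HZ u (mem_behead (s := y :: Z1) uZ)).
have [g [def_y bg [gl gc]]] := HZ y (mem_head _ _).
exists (g :: gs); split=> /=; first by rewrite def_y.
  by move=> h; rewrite inE => /predU1P[->|/bl].
have flx : flatten gs = [::] \/ x \in flatten gs.
  have [->|/eqP gs0] := eqVneq gs [::]; first by left.
  by have [s ->] := flatten_blocks_head bl gs0; right; apply: mem_head.
split=> [z|m0 z z'].
  by rewrite mem_cat => /orP[zg|/fl//]; apply: gl; rewrite inE zg orbT.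
have cx u : u \in g ++ flatten gs -> compatible m x u /\ compatible m u x.
  rewrite mem_cat => /orP[ug|us].
    by split; apply: gc; rewrite ?inE ?eqxx ?ug ?orbT.
  have x_fl : x \in flatten gs by case: flx us => [->|].
  by split; apply: fc.
by move=> /cx[_ zx] /cx[xz' _]; apply: trans zx xz'.
Qed.

(** A joint induction: transitivity at [m + 1] needs readability at [m], and readability at [m + 1]
    needs both claims at [m]. *)
Lemma parses_all m : parses m /\
  (forall u v w : word, compatible m u v -> compatible m v w -> compatible m u w).
Proof.
elim: m => [|m [R trans]].
  split=> [Z _ [lev _]|u v w /compatible_inv //].
  rewrite /letters /=; elim: Z => //= z Z IHZ in lev *.
  have [i ->] := level_inv (lev z (mem_head _ _)).
  by rewrite /= IHZ // => y yZ; apply: lev; rewrite inE yZ orbT.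
split; last exact: compatible_trans_step.
move=> Z Z0 fZ; have [x [gs [def_Z bl f]]] := alphabet_blocks R trans Z0 fZ.
have gs0 : gs <> [::] by move=> gs0; rewrite def_Z gs0 in Z0.
have [s def_s] := flatten_blocks_head bl gs0.
have -> : flatten Z = flatten (flatten gs).
  by rewrite def_Z; elim: gs {def_Z bl f gs0 def_s} => //= g gs ->; rewrite flatten_cat.
(* The first [m] regroupings recover the factors, and the last one cuts them into blocks. *)
rewrite iterS R //; last by rewrite def_s.
by rewrite /regroup {1}def_s blocks_flatten.
Qed.

Lemma alphabet_blocksP m Z : Z <> [::] -> alphabet m.+1 Z ->
  exists x gs, [/\ Z = [seq flatten g | g <- gs],
    forall g, g \in gs -> is_block x g & alphabet m (flatten gs)].
Proof. by have [R trans] := parses_all m; apply: alphabet_blocks. Qed.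

Lemma blocks_alphabet m x gs : (forall g, g \in gs -> is_block x g) ->
  alphabet m (flatten gs) -> alphabet m.+1 [seq flatten g | g <- gs].
Proof.
move=> bl f.
have D g : g \in gs ->
    exists k ys, flatten g = power_cat x k ys /\ decomposition m x k ys.
  move=> g_gs; have [k [ys [def_g k0 ys0 xys]]] := bl g g_gs.
  exists k, ys; rewrite def_g; split=> //; apply: decomposition_block => //.
  apply: alphabet_sub f => y y_xys; apply/flattenP; exists g => //.
  rewrite def_g mem_cat mem_nseq k0 /=.
  by move: y_xys; rewrite inE.
split=> [_ /mapP[g /D[k [ys [-> D1]]] ->]|_ u v]; first exact: LevelS.
case/mapP=> g /D[k [ys [-> D1]]] -> /mapP[g' /D[k' [ys' [-> D2]]] ->].
exact: Compatible D1 D2.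
Qed.

(** At equal levels this is readability. If [m < m'], the word is a single item after [m + 1]
    regroupings and stays so, while the second decomposition makes [m'] regroupings yield at least
    two items. *)
Lemma decomposition_uniq m x k ys m' x' k' ys' :
  decomposition m x k ys -> decomposition m' x' k' ys' ->
  power_cat x k ys = power_cat x' k' ys' ->
  m = m' /\ nseq k x ++ ys = nseq k' x' ++ ys'.
Proof.
wlog le_mm' : m x k ys m' x' k' ys' / m <= m'.
  move=> IH D D' e; case: (leqP m m') => [le|/ltnW le]; first exact: IH.
  by have [-> ->] := IH _ _ _ _ _ _ _ _ le D' D (esym e).
move=> D D' eq_w; move: le_mm'; rewrite leq_eqVlt => /predU1P[eq_m|lt_mm'].
  split=> //; have D1 : decomposition m x' k' ys' by rewrite eq_m.
  by have [R _] := parses_all m; exact: (parses_inj R D D1 eq_w).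
have [R _] := parses_all m.+1; have [R' _] := parses_all m'.
have [_ b' _ f'] := decomposition_inv D'.
have f1 : alphabet m.+1 [:: power_cat x k ys].
  split=> [y|_ y z]; rewrite !inE => /eqP->; first exact: LevelS.
  by move=> /eqP ->; exact: (Compatible D D).
have := size_block b'; rewrite -(R' _ _ f'); last first.
  by move=> e0; have := size_block b'; rewrite e0.
rewrite -/(power_cat _ _ _) -eq_w -(subnK lt_mm') iterD.
have -> : iter m.+1 regroup (letters (power_cat x k ys)) = [:: power_cat x k ys].
  by rewrite -[in letters _](cats0 (power_cat x k ys)) [LHS](R [:: _]).
by rewrite ltnNge size_iter_regroup1.
Qed.

End Levels.

(** * Order and existence of bracketings *)

Lemma common_prefix (T : eqType) (a b : seq T) :
  [\/ exists e, b = a ++ e, exists e, a = b ++ e |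
      exists c u v a' b', [/\ a = c ++ u :: a', b = c ++ v :: b' & u != v]].
Proof.
elim: a b => [|u a IHa] [|v b]; first by constructor 1; exists [::].
- by constructor 1; exists (v :: b).
- by constructor 2; exists (u :: a).
have [->|uv] := eqVneq u v; last first.
  by constructor 3; exists [::], u, v, a, b.
have [[e ->]|[e ->]|[c [u' [v' [a' [b' [-> -> uv']]]]]]] := IHa b.
- by constructor 1; exists e.
- by constructor 2; exists e.
- by constructor 3; exists (v :: c), u', v', a', b'.
Qed.

(** * Lexicographic comparison of sequences of words *)

Section LexCode.

Variable d : nat.
Notation word := (seq 'I_d).
Implicit Types (w x y z p q : word) (Z s t g ys : seq word) (gs : seq (seq word)).

Local Open Scope nat_scope.

(* Sequences over [Z] with distinct first items compare like these items, even
   when one of them is a prefix of the other. *)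
Definition lex_code Z := forall p q s t,
  p \in Z -> q \in Z -> {subset s <= Z} -> {subset t <= Z} ->
  lexlt p q -> lexlt (p ++ flatten s) (q ++ flatten t).

Lemma lexlt_nil w : ~ lexlt w [::].
Proof. by rewrite /lexlt ltxis0. Qed.

Lemma lex_code_sub Z Z' : {subset Z' <= Z} -> lex_code Z -> lex_code Z'.
Proof.
move=> sZ C p q s t /sZ pZ /sZ qZ ss st; apply: C => //.
  by move=> y /ss/sZ.
by move=> y /st/sZ.
Qed.

(** If some [z] were smaller than [x], the rotation starting at [z] would be smaller than the word,
    because the first items decide. *)
Lemma lyndon_head_min x s : lex_code (x :: s) -> [::] \notin x :: s ->
  lyndon (flatten (x :: s)) -> forall z, z \in s -> z != x -> lexlt x z.
Proof.
move=> C n0 lyn z z_s /eqP zx; have [zx_lt|//] := lexlt_total zx.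
case/splitPr: z_s C n0 lyn => s1 s2 C n0 lyn; exfalso.
have nonnil y : y \in x :: s1 ++ z :: s2 -> y <> [::].
  by move=> y_in y0; rewrite -y0 y_in in n0.
have zin : z \in x :: s1 ++ z :: s2 by rewrite inE mem_cat mem_head !orbT.
have lt1 : lexlt (z ++ flatten (s2 ++ x :: s1)) (x ++ flatten (s1 ++ z :: s2)).
  apply: C => //; first exact: mem_head; last by move=> y y_in; rewrite inE y_in orbT.
  move=> y; rewrite !(mem_cat, inE) => /or3P[->|->|->]; by rewrite ?orbT.
apply: (lexlt_asym lt1).
have -> : x ++ flatten (s1 ++ z :: s2) = flatten (x :: s1) ++ flatten (z :: s2).
  by rewrite /= flatten_cat catA.
have -> : z ++ flatten (s2 ++ x :: s1) = flatten (z :: s2) ++ flatten (x :: s1).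
  by rewrite /= flatten_cat catA.
apply: lyndon_rot_lt.
- by case: x nonnil {C n0 lyn lt1 zx zx_lt zin} => // /(_ [::] (mem_head _ _)).
- by move=> /=; case: z nonnil zin {C n0 lyn lt1 zx zx_lt} => // /(_ [::]) H /H.
- by move: lyn; rewrite /= flatten_cat catA.
Qed.

(** The nonempty [zs] has already ended the run of [x], so [e] lies in the [x]-free part of the
    longer block. *)
Lemma nseq_cat_rest (T : eqType) (x : T) k k' (zs zs' e : seq T) :
  0 < size zs -> x \notin zs -> x \notin zs' ->
  nseq k' x ++ zs' = (nseq k x ++ zs) ++ e -> x \notin e.
Proof.
move=> zs0 xzs xzs'; elim: k k' => [|k IHk] [|k'] /=.
- by move=> def_zs'; move: xzs'; rewrite def_zs' mem_cat negb_or => /andP[].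
- by case: zs zs0 xzs => // z zs _; rewrite inE negb_or => /andP[/eqP xz _] [].
- by move=> def_zs'; rewrite def_zs' mem_head in xzs'.
- by case=> /IHk.
Qed.

Lemma flatten_blocks x gs s :
  (forall g, g \in gs -> is_block x g) ->
  {subset s <= [seq flatten g | g <- gs]} ->
  exists s', [/\ flatten s = flatten s', {subset s' <= flatten gs} &
                 s' = [::] \/ exists s'', s' = x :: s''].
Proof.
move=> bl; elim: s => [|y s IHs] ss; first by exists [::]; split=> //; left.
have [|s' [def_s ss' _]] := IHs; first by move=> z zs; apply: ss; rewrite inE zs orbT.
have /mapP[g g_gs ->] := ss y (mem_head _ _).
exists (g ++ s'); rewrite /= flatten_cat def_s; split=> //; last first.
  by have [g' ->] := is_block_cons (bl _ g_gs); right; exists (g' ++ s').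
by move=> z; rewrite mem_cat => /orP[zg|/ss'//]; apply/flattenP; exists g.
Qed.

(** Blocks that differ at some item are decided there by the code property one level down. If
    [b = a ++ e], then [e] starts with an item larger than [x], while whatever follows [a] is empty
    or starts with [x]. *)
Lemma lex_code_blocks x gs : [::] \notin flatten gs -> lex_code (flatten gs) ->
  (forall g, g \in gs -> is_block x g) ->
  (forall g, g \in gs -> lyndon (flatten g)) ->
  lex_code [seq flatten g | g <- gs].
Proof.
move=> n0 C bl lyn.
have sub g : g \in gs -> {subset g <= flatten gs}.
  by move=> g_gs z zg; apply/flattenP; exists g.
(* Each block spells a Lyndon word, so its first item [x] is its smallest. *)
have min z : z \in flatten gs -> z != x -> lexlt x z.
  case/flattenP=> g g_gs zg zx.
  have [g' def_g] := is_block_cons (bl _ g_gs).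
  have sg := sub g g_gs; have := lyn _ g_gs; rewrite def_g.
  move/lyndon_head_min; apply=> //.
  - by apply: lex_code_sub C; rewrite -def_g.
  - by apply: contra n0 => ?; apply: sg; rewrite def_g.
  - by move: zg; rewrite def_g inE (negPf zx).
move=> _ _ s t /mapP[a a_gs ->] /mapP[b b_gs ->].
move=> /(flatten_blocks bl)[s' [-> ss' hs']] /(flatten_blocks bl)[t' [-> st' _]] lt_ab.
have cat2 (u v : seq word) : {subset u <= flatten gs} -> {subset v <= flatten gs} ->
    {subset u ++ v <= flatten gs}.
  by move=> su sv y; rewrite mem_cat => /orP[/su|/sv].
have [[e def_b]|[e def_a]|[c [u [v [a' [b' [def_a def_b uv]]]]]]] := common_prefix a b.
- have [k [zs [def_a k0 zs0 xzs]]] := bl a a_gs.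
  have [k' [zs' [def_b' k0' zs0' xzs']]] := bl b b_gs.
  have xe : x \notin e.
    apply: (nseq_cat_rest (k := k) (k' := k') zs0 xzs xzs').
    by rewrite -def_a -def_b -def_b'.
  have se : {subset e <= flatten gs}.
    by move=> z ze; apply: (sub b) => //; rewrite def_b mem_cat ze orbT.
  rewrite def_b !flatten_cat -catA; apply/lexlt_cat2l.
  case: e => [|z e] in def_b xe se *.
    by case: (@lexlt_irr _ (flatten a)); move: lt_ab; rewrite def_b cats0.
  have zgs : z \in flatten gs by apply: se; rewrite mem_head.
  have z0 : z <> [::] by move=> z0; rewrite -z0 zgs in n0.
  rewrite /= -catA -flatten_cat.
  case: hs' ss' => [->|[s'' ->]] ss'; first by apply: (lexlt_prefix [::]); case: (z) z0.
  apply: C => //; first by apply: ss'; rewrite mem_head.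
  + by move=> y ys; apply: ss'; rewrite inE ys orbT.
  + by apply: cat2 => // y ye; apply: se; rewrite inE ye orbT.
  + by apply: min => //; move: xe; rewrite inE negb_or eq_sym => /andP[].
- move: lt_ab; rewrite def_a flatten_cat -[X in lexlt _ X]cats0.
  by move/lexlt_cat2l/lexlt_nil.
have sa : {subset u :: a' <= flatten gs}.
  by move=> y ya; apply: (sub a) => //; rewrite def_a mem_cat ya orbT.
have sb : {subset v :: b' <= flatten gs}.
  by move=> y yb; apply: (sub b) => //; rewrite def_b mem_cat yb orbT.
have sa' : {subset a' <= flatten gs} by move=> y ya; apply: sa; rewrite inE ya orbT.
have sb' : {subset b' <= flatten gs} by move=> y yb; apply: sb; rewrite inE yb orbT.
have [lt_uv|lt_vu] := lexlt_total (elimN eqP uv).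
  have lt1 : lexlt (u ++ flatten (a' ++ s')) (v ++ flatten (b' ++ t')).
    apply: C => //; [exact: sa (mem_head _ _) | exact: sb (mem_head _ _) | |];
      exact: cat2.
  rewrite def_a def_b -!flatten_cat -!catA !(flatten_cat c).
  exact: (proj2 (lexlt_cat2l _ _ _) lt1).
(* The opposite order of [u] and [v] would give [flatten b < flatten a]. *)
have lt1 : lexlt (v ++ flatten b') (u ++ flatten a').
  by apply: C => //; [exact: sb (mem_head _ _) | exact: sa (mem_head _ _)].
case: (lexlt_asym lt_ab); rewrite def_a def_b !(flatten_cat c).
exact: (proj2 (lexlt_cat2l _ _ _) lt1).
Qed.

Lemma lyndon_power x z k : lyndon x -> lyndon z -> lexlt x z ->
  lyndon (flatten (nseq k x) ++ z).
Proof.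
move=> lx lz xz; elim: k => //= k IHk; rewrite -catA; apply: lyndon_cat => //.
case: k {IHk} => //= k; rewrite -catA; apply: lexlt_prefix.
by case: lz; case: (flatten _).
Qed.

(** Items are appended one at a time: what is already built starts with [x], hence is smaller than
    the next item [z > x], and [lyndon_cat] applies. *)
Lemma lyndon_block x g : lex_code g -> is_block x g ->
  (forall z, z \in g -> lyndon z) ->
  (forall z, z \in g -> z != x -> lexlt x z) -> lyndon (flatten g).
Proof.
move=> C [k [zs [def_g k0 zs0 xzs]]]; move: C; rewrite {g}def_g.
elim/last_ind: zs => // zs z IHzs in zs0 xzs * => C lyn min.
rewrite mem_rcons inE negb_or eq_sym in xzs; case/andP: xzs => zx xzs.
have xin : x \in nseq k x ++ rcons zs z by rewrite mem_cat mem_nseq k0 eqxx.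
have zin : z \in nseq k x ++ rcons zs z by rewrite mem_cat mem_rcons mem_head orbT.
have lz := lyn z zin; have lx := lyn x xin; have xz := min z zin zx.
case: zs => [|y zs] in zs0 xzs IHzs C lyn min xin zin *.
  by rewrite flatten_cat /= cats0; apply: lyndon_power.
have sub : {subset nseq k x ++ y :: zs <= nseq k x ++ rcons (y :: zs) z}.
  by move=> u u_in; rewrite -cats1 catA mem_cat u_in.
rewrite -cats1 catA flatten_cat /= cats0; apply: lyndon_cat => //.
  apply: IHzs => //; first exact: lex_code_sub C.
  - by move=> u /sub/lyn.
  - by move=> u /sub/min.
case: k k0 {IHzs lyn min} xin zin sub C => // k _ xin zin sub C.
rewrite -[z in lexlt _ z]cats0 /=.
apply: (C x z (nseq k x ++ y :: zs) [::]) => //.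
by move=> u us; apply: sub; rewrite inE us orbT.
Qed.

End LexCode.

(** * Existence of bracketings *)

Section Bracketed.

Variables (K : fieldType) (V : vectType K) (d : nat) (X : d.-tuple V).
Notation word := (seq 'I_d).
Implicit Types (w x y z p q : word) (Z s g ys : seq word) (gs : seq (seq word)).

Local Open Scope nat_scope.

Definition bracketed w := exists t, bracketing X w t.

Lemma bracketed_inv w : bracketed w -> (exists i, w = [:: i]) \/
  exists m x k ys, [/\ decomposition m x k ys, w = power_cat x k ys, lyndon w &
                       forall z, z \in x :: ys -> bracketed z].
Proof.
case=> t; case=> [i|m x k y ys f D lyn Hf]; first by left; exists i.
by right; exists m, x, k, (y :: ys); split=> // z zin; exists (f z); apply: Hf.
Qed.

Lemma lyndon_letter (i : 'I_d) : lyndon [:: i].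
Proof. by split=> // -[]. Qed.

Lemma bracketed_lyndon w : bracketed w -> lyndon w.
Proof.
by case/bracketed_inv=> [[i ->]|[? [? [? [? []]]]]] //; apply: lyndon_letter.
Qed.

Lemma bracketed_nil Z : (forall z, z \in Z -> bracketed z) -> [::] \notin Z.
Proof. by move=> H; apply/negP => /H/bracketed_lyndon[]. Qed.

Lemma block_decomposition m x g : is_block x g -> alphabet m g ->
  exists k y ys, g = nseq k x ++ y :: ys /\ decomposition m x k (y :: ys).
Proof.
case=> k [[|y ys] [-> k0 // ys0 xys]] f; exists k, y, ys; split=> //.
apply: decomposition_block => //; apply: alphabet_sub f => z.
by rewrite inE mem_cat mem_nseq k0.
Qed.

(** The bracketing might come from another decomposition; uniqueness identifies the two. A
    one-letter word is excluded, since regrouping it never yields two items. *)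
Lemma bracketed_block m x g : is_block x g -> alphabet m g ->
  bracketed (flatten g) -> forall z, z \in g -> bracketed z.
Proof.
move=> b f; have [k [y [ys [def_g D]]]] := block_decomposition b f.
case/bracketed_inv=> [[i def_w]|[m' [x' [k' [ys' [D' def_w _ Hz]]]]]].
  have [R _] := @parses_all d m; have g0 : g <> [::] by case: (g) (size_block b).
  have := size_block b; rewrite -(R _ g0 f) def_w.
  by rewrite ltnNge size_iter_regroup1.
rewrite {1}def_g in def_w; have [_ eq_g] := decomposition_uniq D D' def_w.
rewrite def_g eq_g => z z_in; apply: Hz; move: z_in.
by rewrite inE mem_cat mem_nseq => /orP[/andP[_ ->]|->]; rewrite ?orbT.
Qed.

Lemma alphabet_lex_code m Z : alphabet m Z -> (forall z, z \in Z -> bracketed z) ->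
  lex_code Z.
Proof.
elim: m Z => [|m IHm] Z fZ bZ.
  case: fZ => lev _ p q s t /lev/level_inv[i ->] /lev/level_inv[j ->] _ _.
  case/lexlt_cons=> [ij|[_ /lexlt_nil//]].
  by apply/lexlt_cons; left.
have [->|/eqP Z0] := eqVneq Z [::]; first by [].
have [x [gs [def_Z bl f]]] := alphabet_blocksP Z0 fZ.
have bgs z : z \in flatten gs -> bracketed z.
  case/flattenP=> g g_gs; apply: bracketed_block (bl g g_gs) _ _ _.
    by apply: alphabet_sub f => y yg; apply/flattenP; exists g.
  by apply: bZ; rewrite def_Z map_f.
rewrite def_Z; apply: lex_code_blocks bl _; first exact: bracketed_nil.
  exact: IHm.
by move=> g g_gs; apply/bracketed_lyndon/bZ; rewrite def_Z map_f.
Qed.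

Lemma lyndon_bracketP w : bracketed w -> bracketing X w (lyndon_bracket X w).
Proof. exact: epsilon_spec. Qed.

(** The items of level [m] are grouped into blocks that are again Lyndon words, hence items of level
    [m + 1]. A block has at least two items, so their number drops until the word is a single
    item. *)
Lemma bracketed_flatten m Z : alphabet m Z -> (forall z, z \in Z -> bracketed z) ->
  lyndon (flatten Z) -> bracketed (flatten Z).
Proof.
have [n] := ubnP (size Z); elim: n m Z => // n IHn m Z leZn fZ bZ lyn.
have C := alphabet_lex_code fZ bZ; have n0 := bracketed_nil bZ.
case: Z => [|x s] in leZn fZ bZ lyn C n0 *; first by case: lyn.
have min := lyndon_head_min C n0 lyn.
case/lastP: s => [|s z] in leZn fZ bZ lyn C n0 min *.
  by rewrite /= cats0; apply: bZ; rewrite mem_head.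
have x0 : x <> [::] by move=> x0; rewrite x0 mem_head in n0.
have zx : z != x.
  (* If [z = x], the proper suffix [z] would also be a proper prefix, hence smaller than the
     word. *)
  apply/eqP=> zx; have /lyndon_suffix[_ /(_ (flatten (x :: s)) z)] := lyn.
  rewrite zx => /(_ _ x0); rewrite -[rcons s x]cats1 /= flatten_cat /= cats0 -catA.
  case/(_ _ erefl)/lexlt_asym; first by case: (x) x0.
  by apply: lexlt_prefix; case: (flatten s) (x) x0 => // ? ? [].
have [zs [gs [def_s xzs bl]]] := exists_blocks (x :: s) zx.
(* The sequence starts with [x], so its [x]-free prefix is empty. *)
case: zs => [|y zs] in def_s xzs; last first.
  by case: def_s xzs => <- _; rewrite mem_head.
rewrite rcons_cons /= in def_s; rewrite def_s in leZn fZ bZ lyn C n0 *.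
have sub g : g \in gs -> {subset g <= flatten gs}.
  by move=> g_gs y yg; apply/flattenP; exists g.
have flat2 : flatten (flatten gs) = flatten [seq flatten g | g <- gs].
  by elim: (gs) => //= g gs' <-; rewrite flatten_cat.
rewrite flat2 in lyn *; apply: (IHn m.+1) => //.
- rewrite size_map; suff: size gs < size (flatten gs).
    by move=> lt_gs; apply: leq_trans lt_gs _; rewrite -ltnS.
  have: gs <> [::] by move=> gs0; rewrite gs0 in def_s.
  elim: gs bl {def_s leZn fZ bZ lyn C n0 sub flat2} => // g [|g' gs] IHgs bl _.
    by rewrite /= cats0; apply: size_block (bl g (mem_head _ _)).
  have := size_block (bl g (mem_head _ _)).
  have: size (g' :: gs) < size (flatten (g' :: gs)).
    by apply: IHgs => // h h_in; apply: bl; rewrite inE h_in orbT.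
  move=> h1 h2; rewrite [flatten (g :: _)]/(g ++ flatten (g' :: gs)) (size_cat g).
  exact: leq_add (ltnW h2) h1.
- exact: blocks_alphabet bl fZ.
move=> _ /mapP[g g_gs ->]; have bg := bl g g_gs; have sg := sub g g_gs.
have fg : alphabet m g by apply: alphabet_sub fZ.
have lg : lyndon (flatten g).
  apply: lyndon_block bg _ _; first exact: lex_code_sub C.
    by move=> y /sg/bZ/bracketed_lyndon.
  move=> y /sg; rewrite -def_s inE => /predU1P[->|]; first by rewrite eqxx.
  exact: min.
have [k [y [ys [def_g D]]]] := block_decomposition bg fg.
have [k0 _ _ _] := decomposition_inv D.
rewrite def_g in lg *; eexists; apply: BracketingSimple D lg _ => u u_in.
apply/lyndon_bracketP/bZ/sg; rewrite def_g mem_cat mem_nseq k0 /=.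
by move: u_in; rewrite inE.
Qed.

(** The climb starts from the letters, at level 0. Hence [lyndon_bracket] does choose a
    bracketing. *)
Lemma lyndon_bracketed w : lyndon w -> bracketed w.
Proof.
have def_w : flatten (letters w) = w by elim: (w) => //= i w' ->.
rewrite -{2}def_w -{1}def_w; apply: (@bracketed_flatten 0).
  by split=> // _ /mapP[i _ ->]; apply: Level0.
by move=> _ /mapP[i _ ->]; eexists; apply: BracketingLetter.
Qed.

End Bracketed.

(** * Expansion of trees *)

Section Steps.

Local Open Scope nat_scope.

Definition steps (T : Type) (q : seq T) : seq (T * T) := zip q (behead q).

Lemma steps_map (S T : Type) (f : S -> T) q :
  steps (map f q) = [seq (f e.1, f e.2) | e <- steps q].
Proof.
rewrite /steps behead_map; elim: q (behead q) => [|x q IHq] [|y r] //=.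
by rewrite IHq.
Qed.

Lemma steps_cat (T : Type) (x y : T) q s :
  steps ((x :: q) ++ y :: s) = steps (x :: q) ++ (last x q, y) :: steps (y :: s).
Proof.
elim: q x => // z q IHq x.
by rewrite {1}/steps /=; congr cons; apply: IHq.
Qed.

Lemma size_steps (T : Type) (q : seq T) : size (steps q) = (size q).-1.
Proof. by rewrite size_zip size_behead; apply/minn_idPr/leq_pred. Qed.

Variable A : eqType.
Implicit Types (q : seq (seq bool * A)) (b : bool) (t l r : tree A).

(** If the long graph visits the leaves in the order [q], these are the values of [beta] on its
    edges. *)
Definition meets q : seq (seq bool) :=
  [seq meet_addr e.1.1 e.2.1 | e <- steps q].

Definition branch b (p : seq bool * A) : seq bool * A := (b :: p.1, p.2).

Lemma leaves_Bracket l r : leaves (Bracket l r) =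
  map (branch false) (leaves l) ++ map (branch true) (leaves r).
Proof. by []. Qed.

Lemma size_leaves_gt0 t : 0 < size (leaves t).
Proof. by elim: t => //= l IHl r IHr; rewrite size_cat !size_map addn_gt0 IHl. Qed.

Lemma size_internal_vertices t : size (internal_vertices t) = (size (leaves t)).-1.
Proof.
elim: t => //= l IHl r IHr; rewrite !size_cat !size_map IHl IHr.
move: (size_leaves_gt0 l) (size_leaves_gt0 r).
by case: size => // m; case: size => // n; rewrite addnS.
Qed.

Lemma uniq_internal_vertices t : uniq (internal_vertices t).
Proof.
elim: t => //= l IHl r IHr.
rewrite cat_uniq !map_inj_uniq ?IHl ?IHr //; try by move=> ? ? [].
rewrite mem_cat; apply/andP; split.
  by apply/norP; split; apply/mapP => -[].
by rewrite andbT; apply/hasPn => _ /mapP[p _ ->]; apply/mapP => -[].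
Qed.

(** Leaves are compared by address rather than by number, because addresses restrict well to a
    branch. *)
Fixpoint before (p q : seq bool) : bool :=
  match p, q with
  | b :: p', c :: q' => if b == c then before p' q' else c
  | _, _ => false
  end.

Lemma before_irr p : before p p = false.
Proof. by elim: p => //= b p ->; rewrite eqxx. Qed.

Lemma before_asym (p q : seq bool) : before p q -> before q p = false.
Proof.
elim: p q => [|b p IHp] [|c q] //=; rewrite eq_sym.
by case: eqVneq => [_ /IHp|]; case: b c => [] [].
Qed.

Lemma pairwise_before t : pairwise before (map fst (leaves t)).
Proof.
elim: t => //= l IHl r IHr; rewrite map_cat pairwise_cat; apply/and3P; split.
- by apply/allrelP => p q /mapP[_ /mapP[x _ ->] ->] /mapP[_ /mapP[y _ ->] ->].
- by rewrite -map_comp pairwise_map; move: IHl; rewrite pairwise_map; apply: sub_pairwise.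
- by rewrite -map_comp pairwise_map; move: IHr; rewrite pairwise_map; apply: sub_pairwise.
Qed.

Lemma meets_branch b q : meets (map (branch b) q) = map (cons b) (meets q).
Proof.
rewrite /meets steps_map -!map_comp; apply: eq_map => -[x y] /=.
by rewrite eqxx.
Qed.

Lemma meets_branch_cat b q1 q2 : q1 <> [::] -> q2 <> [::] ->
  meets (map (branch b) q1 ++ map (branch (~~ b)) q2) =
  map (cons b) (meets q1) ++ [::] :: map (cons (~~ b)) (meets q2).
Proof.
rewrite -!meets_branch; case: q1 q2 => [|x1 q1] [|x2 q2] // _ _.
by rewrite /meets !map_cons steps_cat map_cat map_cons last_map; case: b.
Qed.

(** The default is harmless: the leaves of a [Bracket] have nonempty addresses. *)
Definition side (p : seq bool * A) := head false p.1.

Lemma meet_addr_nil (p q : seq bool) : p <> [::] -> q <> [::] ->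
  (meet_addr p q == [::]) = (head false p != head false q).
Proof. by case: p q => [|b p] [|c q] //= _ _; case: (b == c). Qed.

Lemma meets_cons x y q : meets (x :: y :: q) = meet_addr x.1 y.1 :: meets (y :: q).
Proof. by []. Qed.

Lemma same_side x q : (forall p, p \in x :: q -> p.1 <> [::]) ->
  [::] \notin meets (x :: q) -> all (fun p => side p == side x) q.
Proof.
elim: q x => // y q IHq x n0; rewrite meets_cons inE negb_or eq_sym.
rewrite meet_addr_nil; try by apply: n0; rewrite !inE eqxx ?orbT.
rewrite negbK => /andP[/eqP xy /IHq IH] /=; rewrite /side -xy eqxx /=.
by rewrite xy; apply: IH => p pin; apply: n0; rewrite inE pin orbT.
Qed.

(** An edge meets at the root exactly when it changes sides, so a single such edge leaves one
    stretch on each side. *)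
Lemma split_sides x q : (forall p, p \in x :: q -> p.1 <> [::]) ->
  count_mem [::] (meets (x :: q)) = 1 ->
  exists q1 y q2, [/\ q = q1 ++ y :: q2, all (fun p => side p == side x) q1 &
                      all (fun p => side p == ~~ side x) (y :: q2)].
Proof.
elim: q x => // y q IHq x n0; rewrite meets_cons /=.
have n0' p : p \in y :: q -> p.1 <> [::] by move=> pin; apply: n0; rewrite inE pin orbT.
rewrite meet_addr_nil; try by apply: n0; rewrite !inE eqxx ?orbT.
rewrite -[head _ x.1]/(side x) -[head _ y.1]/(side y).
have [xy|xy] /= := eqVneq (side x) (side y).
  rewrite add0n => /(IHq y n0')[q1 [z [q2 [-> s1 s2]]]].
  by exists (y :: q1), z, q2; rewrite xy /= eqxx s1.
rewrite -[1]addn0 => /eqP; rewrite eqn_add2l => /eqP c0.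
exists [::], y, q; split=> //.
have -> : ~~ side x = side y by case: (side x) (side y) xy => [] [].
rewrite /= eqxx; apply: same_side => //.
by rewrite -has_pred1 has_count c0.
Qed.

End Steps.

(** * Coefficients of words in the expansion of a tree *)

Section Coefficient.

Variables (K : fieldType) (I : Type) (A : eqType) (phi : I -> A -> K).
Implicit Types (q : seq (seq bool * A)) (b : bool) (t l r : tree A) (w : seq I).

Definition sgn (p1 p2 : seq bool * A) : K := if before p1.1 p2.1 then 1 else -1.

(** The summand of the pairing at a bijection, which is given here as the ordering [q] of the
    leaves. *)
Definition config_term t w q : K :=
  if all [in meets q] (internal_vertices t) then
    \prod_(e <- steps q) sgn e.1 e.2 * \prod_(p <- zip w q) phi p.1 p.2.2
  else 0.

(* The coefficient of [w] in the expansion of [t] in the tensor algebra. *)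
Definition coefficient t w : K :=
  \sum_(q <- permutations (leaves t)) config_term t w q.

Definition child b l r := if b then r else l.

Lemma perm_branch b q s : perm_eq q (map (@branch A b) s) ->
  exists2 q', q = map (branch b) q' & perm_eq q' s.
Proof.
pose g (p : seq bool * A) := (behead p.1, p.2).
have gK : cancel (branch b) g by case.
move=> qs; exists (map g q); last first.
  by rewrite -[s](mapK gK); apply: perm_map.
rewrite -map_comp -[LHS]map_id; apply/eq_in_map => p; rewrite (perm_mem qs).
by case/mapP=> p' _ ->.
Qed.

Lemma filter_side b c s :
  [seq p <- map (@branch A b) s | side p == c] =
  if b == c then map (branch b) s else [::].
Proof.
rewrite filter_map; case: eqP => [<-|bc].
  by congr map; rewrite -[RHS]filter_predT; apply: eq_filter => p /=; rewrite /side eqxx.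
rewrite -[RHS]/(map (branch b) [::]); congr map.
by rewrite -(filter_pred0 s); apply: eq_filter => p /=; rewrite /side /=; apply/eqP.
Qed.

Lemma filter_leaves_side b l r :
  [seq p <- leaves (Bracket l r) | side p == b] =
  map (branch b) (leaves (child b l r)).
Proof. by rewrite leaves_Bracket filter_cat !filter_side; case: b; rewrite ?cats0. Qed.

(** The path has as many edges as the tree has internal vertices, so surjectivity hits each vertex
    exactly once. For the root this means one crossing: one branch is exhausted before the other is
    entered. *)
Lemma perm_bracket_split l r q : perm_eq q (leaves (Bracket l r)) ->
  all [in meets q] (internal_vertices (Bracket l r)) ->
  exists b q1 q2, [/\ q = map (branch b) q1 ++ map (branch (~~ b)) q2,
    perm_eq q1 (leaves (child b l r)) & perm_eq q2 (leaves (child (~~ b) l r))].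
Proof.
move=> pq /allP sub.
have szm : (size (meets q) <= size (internal_vertices (Bracket l r)))%N.
  by rewrite size_map size_steps size_internal_vertices (perm_size pq).
have unq := uniq_internal_vertices (Bracket l r).
have [eq_sz eq_m] := uniq_min_size unq sub szm.
have c1 : count_mem [::] (meets q) = 1%N.
  rewrite count_uniq_mem; first by rewrite -eq_m mem_head.
  by apply: leq_size_uniq unq sub szm.
have n0 p : p \in q -> p.1 <> [::].
  rewrite (perm_mem pq) leaves_Bracket mem_cat.
  by case/orP=> /mapP[p' _ ->].
case: q => [|x q] // in pq sub szm eq_sz eq_m c1 n0 *.
have [q1 [y [q2 [def_q s1 s2]]]] := split_sides n0 c1.
have f1 : [seq p <- x :: q | side p == side x] = x :: q1.
  rewrite def_q -cat_cons filter_cat /= eqxx (all_filterP s1).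
  rewrite -[RHS]cats0 cat_cons; congr (_ :: (_ ++ _)).
  case/andP: s2 => /eqP-> s2; rewrite (_ : (_ == _) = false); last by case: (side x).
  rewrite -(filter_pred0 q2); apply: eq_in_filter => p /(allP s2)/eqP ->.
  by case: (side x).
have f2 : [seq p <- x :: q | side p == ~~ side x] = y :: q2.
  rewrite def_q -cat_cons filter_cat (all_filterP s2).
  rewrite -[RHS]cat0s; congr (_ ++ _).
  rewrite -(filter_pred0 (x :: q1)); apply: eq_in_filter => p.
  rewrite inE => /predU1P[->|/(allP s1)/eqP ->]; by case: (side x).
have p1 := perm_filter (fun p => side p == side x) pq.
have p2 := perm_filter (fun p => side p == ~~ side x) pq.
rewrite f1 filter_leaves_side in p1; rewrite f2 filter_leaves_side in p2.
have [q1' def_q1 pq1] := perm_branch p1; have [q2' def_q2 pq2] := perm_branch p2.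
by exists (side x), q1', q2'; split=> //; rewrite -def_q1 -def_q2 def_q.
Qed.

Lemma all_in_internal_vertices b l r (M N : seq (seq bool)) :
  all [in map (cons b) M ++ [::] :: map (cons (~~ b)) N]
    (internal_vertices (Bracket l r)) =
  all [in M] (internal_vertices (child b l r)) &&
  all [in N] (internal_vertices (child (~~ b) l r)).
Proof.
have mem_map_cons c e p (M' : seq (seq bool)) :
    (c :: p \in map (cons e) M') = (c == e) && (p \in M').
  have [->|/eqP ce] := eqVneq c e; first by rewrite mem_map // => ? ? [].
  by apply/mapP => -[p' _ [/ce]].
have mem_side c p : (c :: p \in map (cons b) M ++ [::] :: map (cons (~~ b)) N) =
    (p \in if c == b then M else N).
  rewrite mem_cat inE !mem_map_cons /=.
  by case: b c => [] []; rewrite /= ?orbF.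
have all_side c T : all [in map (cons b) M ++ [::] :: map (cons (~~ b)) N]
    (map (cons c) (internal_vertices T)) =
    all [in if c == b then M else N] (internal_vertices T).
  by rewrite all_map; apply: eq_all => p /=; rewrite mem_side.
rewrite /= all_cat !all_side mem_cat mem_head orbT /=.
by case: b {mem_side all_side}; rewrite //= andbC.
Qed.

(** The factor [(-1) ^+ b] is the sign of the crossing edge, which runs leftwards when [b] is true;
    all other edges stay within a branch and keep their signs. *)
Lemma config_term_Bracket b l r w q1 q2 :
  (size (leaves (child b l r)) <= size w)%N ->
  perm_eq q1 (leaves (child b l r)) -> perm_eq q2 (leaves (child (~~ b) l r)) ->
  config_term (Bracket l r) w (map (branch b) q1 ++ map (branch (~~ b)) q2) =
  (-1) ^+ b * (config_term (child b l r) (take (size (leaves (child b l r))) w) q1 *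
    config_term (child (~~ b) l r) (drop (size (leaves (child b l r))) w) q2).
Proof.
move=> szw pq1 pq2.
have q1_0 : q1 <> [::].
  by move=> q1_0; have := size_leaves_gt0 (child b l r); rewrite -(perm_size pq1) q1_0.
have q2_0 : q2 <> [::].
  move=> q2_0; have := size_leaves_gt0 (child (~~ b) l r).
  by rewrite -(perm_size pq2) q2_0.
rewrite /config_term meets_branch_cat // all_in_internal_vertices.
case: (all [in meets q1] _) => /=; last by rewrite mul0r mulr0.
case: (all [in meets q2] _); last by rewrite !mulr0.
rewrite -[in zip w](cat_take_drop (size (leaves (child b l r))) w) zip_cat; last first.
  by rewrite size_takel // size_map (perm_size pq1).
rewrite big_cat /=.
have labels c v q : \prod_(p <- zip v (map (branch c) q)) phi p.1 p.2.2 =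
    \prod_(p <- zip v q) phi p.1 p.2.2.
  by elim: v q => [|i v IHv] [|x q] //=; rewrite ?big_nil // !big_cons IHv.
have signs c q : \prod_(e <- steps (map (branch c) q)) sgn e.1 e.2 =
    \prod_(e <- steps q) sgn e.1 e.2.
  rewrite steps_map big_map; apply: eq_bigr => -[x y] _.
  by rewrite /sgn /= eqxx.
have -> : \prod_(e <- steps (map (branch b) q1 ++ map (branch (~~ b)) q2)) sgn e.1 e.2 =
    \prod_(e <- steps q1) sgn e.1 e.2 * ((-1) ^+ b * \prod_(e <- steps q2) sgn e.1 e.2).
  rewrite -(signs b q1) -(signs (~~ b) q2).
  case: q1 q2 q1_0 q2_0 {pq1 pq2} => [|x1 q1] [|x2 q2] // _ _.
  rewrite !map_cons steps_cat big_cat big_cons /=; congr (_ * (_ * _)).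
  by rewrite last_map /sgn; case: b {szw}.
rewrite !labels -!mulrA mulrCA; congr (_ * (_ * _)).
by rewrite mulrCA.
Qed.

(** This is [[l, r] = l r - r l]: the contributing orderings visit all of one branch first, in the
    family [S false] the left one, in [S true] the right one. *)
Lemma coefficient_Bracket l r w :
  size w = (size (leaves l) + size (leaves r))%N ->
  coefficient (Bracket l r) w =
    coefficient l (take (size (leaves l)) w) * coefficient r (drop (size (leaves l)) w) -
    coefficient r (take (size (leaves r)) w) * coefficient l (drop (size (leaves r)) w).
Proof.
move=> szw.
pose S b := [seq map (branch b) q1 ++ map (branch (~~ b)) q2 |
  q1 <- permutations (leaves (child b l r)),
  q2 <- permutations (leaves (child (~~ b) l r))].
have sumS b : \sum_(q <- S b) config_term (Bracket l r) w q =
    (-1) ^+ b * (coefficient (child b l r) (take (size (leaves (child b l r))) w) *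
      coefficient (child (~~ b) l r) (drop (size (leaves (child b l r))) w)).
  rewrite big_allpairs_dep big_distrlr mulr_sumr; apply: eq_big_seq => q1.
  rewrite mem_permutations => pq1; rewrite mulr_sumr; apply: eq_big_seq => q2.
  rewrite mem_permutations => pq2; apply: config_term_Bracket => //.
  by rewrite szw; case: b {pq1 pq2}; rewrite ?leq_addl ?leq_addr.
have uniqS b : uniq (S b).
  apply: allpairs_uniq; rewrite ?permutations_uniq // => -[q1 q2] [q1' q2'] /=.
  case/allpairsP=> -[? ?] [/= +  _ [-> ->]]; rewrite mem_permutations => p1.
  case/allpairsP=> -[? ?] [/= +  _ [-> ->]]; rewrite mem_permutations => p2.
  move/eqP; rewrite eqseq_cat ?size_map ?(perm_size p1) ?(perm_size p2) //.
  have inj c : injective (map (@branch A c)).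
    by apply: inj_map => -[x u] [y v] [-> ->].
  by case/andP=> /eqP/inj-> /eqP/inj->.
have headS b q : q \in S b -> exists x s, q = branch b x :: s.
  case/allpairsP=> -[q1 q2] [/= + _ ->]; rewrite mem_permutations => p1.
  case: q1 p1 => [|x q1] p1; last by do 2!eexists.
  by have := size_leaves_gt0 (child b l r); rewrite -(perm_size p1).
(* The side of the first leaf visited tells the two families apart. *)
have uniqSS : uniq (S false ++ S true).
  rewrite cat_uniq !uniqS andbT /=; apply/hasPn => q /headS[x [s ->]].
  by apply/negP => /headS[y [s' []]].
(* Orderings outside both families fail surjectivity and contribute 0. *)
rewrite /coefficient (bigID [in S false ++ S true]) /= [X in _ + X]big1_seq; last first.
  move=> q /andP[nS]; rewrite mem_permutations /config_term => pq.
  case: ifP => // /(perm_bracket_split pq)[b [q1 [q2 [def_q p1 p2]]]].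
  case/negP: nS; rewrite mem_cat.
  have: q \in S b by rewrite def_q; apply: allpairs_f; rewrite mem_permutations.
  by case: b {def_q p1 p2} => ->; rewrite ?orbT.
rewrite addr0 -big_filter (perm_big (S false ++ S true)) /=; last first.
  apply: uniq_perm => [||q] //; first by rewrite filter_uniq ?permutations_uniq.
  rewrite mem_filter andb_idr // mem_cat => qS.
  have [b /allpairsP[[q1 q2] /= [p1 p2 ->]]] : exists b, q \in S b.
    by case/orP: qS; [exists false | exists true].
  rewrite mem_permutations; rewrite !mem_permutations in p1 p2.
  case: b p1 p2 => /= p1 p2; first rewrite perm_catC.
    by apply: perm_cat; apply: perm_map.
  by apply: perm_cat; apply: perm_map.
by rewrite big_cat /= !sumS /= mul1r mulN1r.
Qed.

End Coefficient.

(** * The pairing with a long graph as a coefficient, and smallest words of expansions *)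

Section PairingCoefficient.

Variables (K : fieldType) (V : vectType K) (d : nat) (X : d.-tuple V).
Implicit Types (w : seq 'I_d) (t : tree V).

Let phi (i : 'I_d) (v : V) : K := coord X i v.

Lemma before_leaf t (i j : leaf t) :
  before (leaf_addr i) (leaf_addr j) = (i < j)%N.
Proof.
have addrE (k : leaf t) : leaf_addr k = nth [::] (map fst (leaves t)) k.
  by rewrite /leaf_addr (tnth_nth ([::], 0)) (nth_map ([::], 0)).
have lt_before (k m : leaf t) : (k < m)%N -> before (leaf_addr k) (leaf_addr m).
  move=> km; rewrite !addrE; apply: (pairwiseP [::] (pairwise_before t)) => //;
    by rewrite inE size_map.
case: (ltngtP i j) => [/lt_before //|/lt_before/before_asym //|/val_inj ->].
exact: before_irr.
Qed.

Lemma uniq_leaves t : uniq (leaves t).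
Proof.
apply: (@map_uniq _ _ fst); apply: pairwise_uniq (pairwise_before t).
by move=> p; rewrite before_irr.
Qed.

Lemma steps_enum_ord n (i j : 'I_n) :
  ((i, j) \in steps (enum 'I_n)) = (j == i.+1 :> nat).
Proof.
have sz : size (steps (enum 'I_n)) = n.-1 by rewrite size_steps size_enum_ord.
apply/(nthP (i, j))/eqP => [[k]|ji].
  rewrite sz => kn; have k1n : (k.+1 < n)%N by case: (n) kn.
  have kn' := ltnW k1n.
  rewrite nth_zip_cond -[(k < _)%N]/(k < size (steps (enum 'I_n)))%N sz kn.
  rewrite nth_behead => -[<- <-].
  by rewrite !nth_enum_ord.
have i_lt : (i < size (steps (enum 'I_n)))%N.
  by rewrite sz -subn1 ltn_subRL add1n -ji.
exists i => //.
rewrite nth_zip_cond -[(i < _)%N]/(i < size (steps (enum 'I_n)))%N i_lt.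
rewrite nth_behead; congr pair; apply: val_inj; rewrite /= nth_enum_ord //.
by rewrite -ji.
Qed.

Lemma perm_edges_long_graph n :
  perm_eq (enum (edges (long_graph n))) (steps (enum 'I_n)).
Proof.
apply: uniq_perm; first exact: enum_uniq.
  by apply: zip_uniql; apply: enum_uniq.
by move=> [i j]; rewrite steps_enum_ord mem_enum inE.
Qed.

Definition leaf_seq t n (s : {ffun 'I_n -> leaf t}) : seq (seq bool * V) :=
  [seq tnth (in_tuple (leaves t)) (s i) | i <- enum 'I_n].

(** Reading [s] as the sequence of leaves visited turns the edges of the long graph into consecutive
    pairs of leaves. *)
Lemma pairing_term w t (s : {ffun 'I_(size w) -> leaf t}) :
  configuration_pairing (G := long_graph (size w)) s *
    \prod_(v < size w) dual_basis X (tnth (in_tuple w) v) (leaf_label (s v)) =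
  config_term phi t w (leaf_seq s).
Proof.
have -> : \prod_(v < size w) dual_basis X (tnth (in_tuple w) v) (leaf_label (s v)) =
    \prod_(p <- zip w (leaf_seq s)) phi p.1 p.2.2.
  have -> : zip w (leaf_seq s) =
      [seq (tnth (in_tuple w) i, tnth (in_tuple (leaves t)) (s i)) |
        i <- enum 'I_(size w)].
    by rewrite -zip_map map_tnth_enum.
  rewrite big_map big_enum /=.
  by apply: eq_bigr => i _; rewrite /dual_basis lfunE.
rewrite /configuration_pairing /config_term.
have -> : beta_surjective (G := long_graph (size w)) s =
    all [in meets (leaf_seq s)] (internal_vertices t).
  apply: eq_all => p; rewrite [RHS]/= /meets steps_map -map_comp.
  apply/existsP/mapP => [[e /andP[eG /eqP <-]]|[e eS ->]]; exists e => //.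
    by rewrite -(perm_mem (perm_edges_long_graph _)) mem_enum.
  by rewrite -mem_enum (perm_mem (perm_edges_long_graph _)) eS /=.
case: ifP => _; last by rewrite mul0r.
congr (_ * _); rewrite -big_enum (perm_big _ (perm_edges_long_graph _)).
rewrite [steps (leaf_seq s)]steps_map big_map; apply: eq_bigr => e _.
by rewrite /sgn /edge_sign -before_leaf.
Qed.

Lemma leaf_seq_inj t n : injective (@leaf_seq t n).
Proof.
move=> s s' /eq_in_map eq_s; apply/ffunP => i.
have := eq_s i (mem_enum _ i); rewrite !(tnth_nth ([::], 0)).
by move/eqP; rewrite nth_uniq ?uniq_leaves // => /eqP/val_inj.
Qed.

Lemma pairing_coefficient w t : size w = size (leaves t) ->
  pairing (dual_word X w) t = coefficient phi t w.
Proof.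
move=> szw; rewrite /pairing /coefficient.
under eq_bigr do rewrite pairing_term.
rewrite -big_filter -(big_map (@leaf_seq t (size w)) predT (config_term phi t w)).
apply: perm_big; apply: uniq_perm.
- rewrite map_inj_uniq ?filter_uniq ?index_enum_uniq //; exact: leaf_seq_inj.
- exact: permutations_uniq.
move=> q; rewrite mem_permutations; apply/mapP/idP => [[s]|pq].
  rewrite mem_filter => /andP[/andP[/injectiveP inj /forallP surj] _] ->.
  rewrite -[X in perm_eq _ X](map_tnth_enum (in_tuple (leaves t))) /leaf_seq.
  rewrite (map_comp (tnth _) s); apply: perm_map; apply: uniq_perm.
  - by rewrite map_inj_uniq ?enum_uniq.
  - exact: enum_uniq.
  move=> i; rewrite mem_enum; apply/mapP.
  by have /codomP[j ->] := surj i; exists j; rewrite ?mem_enum.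
have szq : size q = size w by rewrite szw (perm_size pq).
pose x0 : seq bool * V := ([::], 0).
have lt_idx (i : 'I_(size w)) :
    (index (nth x0 q i) (leaves t) < size (leaves t))%N.
  by rewrite index_mem -(perm_mem pq) mem_nth // szq.
(* The bijection that realizes [q]: vertex [i] goes to the position, among the leaves, of item [i]
   of [q]. *)
pose s := [ffun i => Ordinal (lt_idx i) : leaf t].
have s_inj : injective s.
  move=> i j /(congr1 (fun k => nth x0 (leaves t) (val k))).
  rewrite !ffunE /= !nth_index -?(perm_mem pq) ?mem_nth ?szq // => /eqP.
  by rewrite nth_uniq ?szq ?(perm_uniq pq) ?uniq_leaves // => /eqP/val_inj.
exists s.
  rewrite mem_filter mem_index_enum andbT /=; apply/andP; split; first exact/injectiveP.
  by apply/forallP; apply: inj_card_onto; rewrite // !card_ord szw.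
apply: (@eq_from_nth _ x0) => [|i]; first by rewrite size_map size_enum_ord.
rewrite szq => i_lt; rewrite (nth_map (Ordinal i_lt)) ?size_enum_ord //.
rewrite (tnth_nth x0) ffunE /= nth_enum_ord // nth_index //.
by rewrite -(perm_mem pq) mem_nth // szq.
Qed.

Lemma pairing_size_neq w t : size w != size (leaves t) ->
  pairing (dual_word X w) t = 0.
Proof.
move=> /eqP szw; apply: big_pred0 => s.
apply/negP => /andP[/injectiveP inj /forallP surj].
have inj' : injective (fun j => iinv (surj j)).
  by move=> i j eq_ij; rewrite -(f_iinv (surj i)) eq_ij f_iinv.
apply: szw; apply/eqP; rewrite eqn_leq.
by have := leq_card _ inj; have := leq_card _ inj'; rewrite !card_ord => -> ->.
Qed.

(** The square expresses [±1] in a form stable under products and sign changes. Only words with one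
    letter per leaf are concerned. *)
Definition leading_word t w :=
  [/\ size w = size (leaves t), coefficient phi t w ^+ 2 = 1 &
      forall v, size v = size w -> lexlt v w -> coefficient phi t v = 0].

(** Either the first [size p] letters of [v] are below [p], or they form [p] and the rest is below
    [q]. *)
Lemma leading_word_vanish l r p q v : leading_word l p -> leading_word r q ->
  size v = (size p + size q)%N -> lexlt v (p ++ q) ->
  coefficient phi l (take (size p) v) * coefficient phi r (drop (size p) v) = 0.
Proof.
move=> [_ _ Hp] [_ _ Hq] szv; rewrite -{1}(cat_take_drop (size p) v).
have szt : size (take (size p) v) = size p by rewrite size_takel // szv leq_addr.
case/(lexlt_catW szt) => [/(Hp _ szt)->|[_ /Hq ->]]; rewrite ?mul0r ?mulr0 //.
by rewrite size_drop szv addKn.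
Qed.

(** The term of [r] before [l] starts only at [q ++ p], so at [p ++ q] the other term is alone, and
    below [p ++ q] both vanish. *)
Lemma leading_word_Bracketl l r p q : leading_word l p -> leading_word r q ->
  lexlt (p ++ q) (q ++ p) -> leading_word (Bracket l r) (p ++ q).
Proof.
move=> lp lq lt_pq; have [szp cp _] := lp; have [szq cq _] := lq.
have sz : size (p ++ q) = size (leaves (Bracket l r)).
  by rewrite leaves_Bracket !size_cat !size_map szp szq.
split=> // [|v szv lt_v].
  rewrite coefficient_Bracket -?szp -?szq ?size_cat //.
  rewrite take_size_cat // drop_size_cat //.
  rewrite (leading_word_vanish lq lp) ?size_cat 1?addnC //.
  by rewrite subr0 exprMn cp cq mulr1.
rewrite size_cat in szv; rewrite coefficient_Bracket -?szp -?szq //.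
rewrite (leading_word_vanish lp lq) // (leading_word_vanish lq lp) ?subrr 1?addnC //.
exact: lexlt_trans lt_v lt_pq.
Qed.

Lemma leading_word_Bracketr l r p q : leading_word l p -> leading_word r q ->
  lexlt (q ++ p) (p ++ q) -> leading_word (Bracket l r) (q ++ p).
Proof.
move=> lp lq lt_pq; have [szp cp _] := lp; have [szq cq _] := lq.
have sz : size (q ++ p) = size (leaves (Bracket l r)).
  by rewrite leaves_Bracket !size_cat !size_map szp szq addnC.
split=> // [|v szv lt_v].
  rewrite coefficient_Bracket -?szp -?szq ?size_cat 1?addnC //.
  rewrite (leading_word_vanish lp lq) ?size_cat 1?addnC //.
  rewrite take_size_cat // drop_size_cat //.
  by rewrite sub0r sqrrN exprMn cp cq mulr1.
rewrite size_cat in szv; rewrite coefficient_Bracket -?szp -?szq 1?addnC //.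
rewrite (leading_word_vanish lq lp) // (leading_word_vanish lp lq) ?subrr 1?addnC //.
exact: lexlt_trans lt_v lt_pq.
Qed.

Lemma leading_word_Leaf i : free X -> leading_word (Leaf (tnth X i)) [:: i].
Proof.
move=> frX.
have coefE j : coefficient phi (Leaf (tnth X i)) [:: j] = (i == j)%:R.
  rewrite /coefficient /= (_ : permutations _ = [:: [:: ([::], tnth X i)]]) //.
  rewrite big_seq1 /config_term /= /steps /= big_nil mul1r big_seq1 /=.
  by rewrite /phi (tnth_nth 0) coord_free.
split=> //; first by rewrite coefE eqxx expr1n.
move=> [|j [|//]] // _ /lexlt_cons[ji|[_ /lexlt_irr//]].
by rewrite coefE; case: eqVneq ji => // ->; rewrite ltxx.
Qed.

(** Bracketing with [x] puts it in front, since it is the smallest factor; bracketing with a later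
    factor puts it at the end, since the word built so far starts with [x]. *)
Lemma bracketing_leading_word w t : free X -> bracketing X w t ->
  leading_word t w.
Proof.
move=> frX; elim=> [i|m x k y ys f D lyn brf IHf]; first exact: leading_word_Leaf.
have [k0 bl alph alph'] := decomposition_inv D.
have brk z : z \in [:: x, y & ys] -> bracketed X z.
  by move=> zin; exists (f z); apply: brf.
have C := alphabet_lex_code alph brk.
have n0 := bracketed_nil brk.
have xys : x \notin y :: ys by case: D.
have min z : z \in y :: ys -> lexlt x z.
  move=> zys; have zx : z != x by apply: contraNneq xys => <-.
  have sub : {subset nseq k x ++ y :: ys <= [:: x, y & ys]}.
    move=> u; rewrite mem_cat mem_nseq => /orP[/andP[_ /eqP->]|u_in].
      exact: mem_head.
    by rewrite inE u_in orbT.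
  case: k k0 {D bl alph'} lyn sub => // k _ lyn sub.
  apply: (@lyndon_head_min _ x (nseq k x ++ y :: ys) _ _ lyn _ _ zx).
  - exact: lex_code_sub sub C.
  - by apply: contra n0; apply: sub.
  - by rewrite mem_cat zys orbT.
have xin : x \in [:: x, y & ys] by rewrite mem_head.
have yin : y \in [:: x, y & ys] by rewrite !inE eqxx orbT.
have ladder j : leading_word (iter j (fun t' => Bracket t' (f x)) (f y))
    (flatten (nseq j x) ++ y).
  elim: j => [|j IHj]; first exact: IHf.
  have commx : x ++ flatten (nseq j x) = flatten (nseq j x) ++ x.
    by elim: (j) => [|n IHn] /=; rewrite ?cats0 // {1}IHn catA.
  rewrite /= -catA; apply: leading_word_Bracketr IHj (IHf x xin) _.
  (* Cancelling [x^j] reduces the comparison of [x x^j y] with [x^j y x] to that of [x y] with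
     [y x]. *)
  rewrite catA commx -!catA; apply/lexlt_cat2l.
  have := C x y [:: y] [:: x]; rewrite /= !cats0; apply=> //.
  + by move=> u; rewrite inE => /eqP->.
  + by move=> u; rewrite inE => /eqP->.
  + by apply: min; rewrite mem_head.
have subk : {subset nseq k.-1 x ++ [:: y] <= [:: x, y & ys]}.
  move=> u; rewrite mem_cat mem_nseq inE => /orP[/andP[_ /eqP->]|/eqP->] //.
have := ladder k.
rewrite /power_cat -cat1s catA flatten_cat.
have -> : flatten (nseq k x) ++ y = flatten (x :: (nseq k.-1 x ++ [:: y])).
  case: k k0 {lyn D bl alph' ladder subk} => //= k _.
  by rewrite flatten_cat /= cats0 catA.
have -> : flatten (nseq k x ++ [:: y]) = flatten (x :: (nseq k.-1 x ++ [:: y])).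
  by case: k k0 {lyn D bl alph' ladder subk}.
(* The tree built so far becomes an arbitrary [T] with leading word [flatten (x :: s)], whose
   initial [x] decides each later comparison. *)
move: (iter _ _ _) (nseq _ _ ++ _) subk => T s.
have: {subset ys <= y :: ys} by move=> u uys; rewrite inE uys orbT.
elim: {1 4 5}ys T s => [|z zs IHzs] T s szs ss leadT; first by rewrite cats0.
have zys : z \in y :: ys by apply: szs; rewrite mem_head.
have zin : z \in [:: x, y & ys] by rewrite inE zys orbT.
have -> : flatten (x :: s) ++ flatten (z :: zs) = flatten (x :: rcons s z) ++ flatten zs.
  by rewrite /= -cats1 flatten_cat /= cats0 -!catA.
apply: IHzs => [u uzs|u|]; first by apply: szs; rewrite inE uzs orbT.
  by rewrite mem_rcons inE => /predU1P[->//|/ss].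
have -> : flatten (x :: rcons s z) = flatten (x :: s) ++ z.
  by rewrite /= -cats1 flatten_cat /= cats0 -!catA.
apply: leading_word_Bracketl leadT (IHf z zin) _.
have := C x z (rcons s z) (x :: s) xin zin.
rewrite -cats1 flatten_cat /= cats0 catA; apply.
- by move=> u; rewrite mem_cat inE => /orP[/ss|/eqP->].
- by move=> u; rewrite inE => /predU1P[->|/ss].
- exact: min.
Qed.

End PairingCoefficient.

Theorem theorem6p4 (K : fieldType) (V : vectType K) (d : nat) (X : d.-tuple V)
    (hX : basis_of fullv X) :
  (forall w u : seq 'I_d, lyndon w -> lyndon u -> lexlt w u ->
     pairing (dual_word X w) (lyndon_bracket X u) = 0) /\
  (forall w : seq 'I_d, lyndon w ->
     pairing (dual_word X w) (lyndon_bracket X w) = 1 \/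
     pairing (dual_word X w) (lyndon_bracket X w) = -1).
Proof.
have lead w : lyndon w -> leading_word X (lyndon_bracket X w) w.
  move=> /(lyndon_bracketed X)/lyndon_bracketP.
  exact: bracketing_leading_word (basis_free hX).
split=> [w u _ /lead[szu _ small] lt_wu|w /lead[szw sq1 _]].
  (* Different lengths admit no bijection; for equal lengths [w] lies below the leading word [u]. *)
  have [szw|szw] := eqVneq (size w) (size (leaves (lyndon_bracket X u))).
    by rewrite pairing_coefficient // small // szw.
  exact: pairing_size_neq.
rewrite pairing_coefficient //.
by move/eqP: sq1; rewrite sqrf_eq1 => /orP[/eqP|/eqP]; [left | right].
Qed.
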